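(* The anonymous failure detector $\mathcal{N}$ is stronger than the anonymous failure detector $\diamond\mathcal{N}$; that is, $\diamond\mathcal{N}$ can be reduced to $\mathcal{N}$.
   Context: Model. $P=\{p_1,\dots,p_n\}$ is a set of $n$ processes; the clock ranges over $\mathbb{N}$. A failure pattern is a function $F:\mathbb{N}\to 2^P$, where $F(t)$ is the set of processes crashed at time $t$; processes fail only by crashing (halting permanently). Put $crashed(F)=\bigcup_{t\in\mathbb{N}}F(t)$ and $correct(F)=P\setminus crashed(F)$; at least one process is correct. An environment $\mathcal{E}$ is a set of possible failure patterns. Each process is connected to every other process by a reliable channel, with unbounded but finite message delays. Communication uses a broadcast primitive and an anonymous receive operation, in which the receiver cannot tell who sent the message; formally, if $R_i(j,t)$ is the value process $i$ receives from process $j$ at time $t$, the anonymous receive operation is given by $R_i^{\Pi}(j,t)=R_i(\Pi(j),t)$ for a permutation $\Pi$ of $P$. Failure detectors. A failure detector $\mathcal{D}$ maps each failure pattern $F$ to a set $\mathcal{D}(F)$ of histories $H:P\times\mathbb{N}\to V_{\mathcal{D}}$, where $H(p,t)$ is the output of the module of $p$ at time $t$. For a permutation $\Pi$ of $P$ put $F^{\Pi}(t)=\Pi(F(t))$ and $H^{\Pi}(p,t)=H(\Pi(p),t)$; $\mathcal{D}$ is called anonymous if $H^{\Pi}\in\mathcal{D}(F^{\Pi})$ for all $\Pi$. For $\mathcal{N}$ and $\diamond\mathcal{N}$ the range is $\{0,1,\dots,n\}$ (the number of processes suspected to have crashed). $\mathcal{N}(F)$ is the set of all $H$ satisfying: (Completeness)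 there is $t\in\mathbb{N}$ such that $H(q,t')\ge |crashed(F)|$ for all $t'\ge t$ and all $q\in P$; (Accuracy) $H(q,t)\le |crashed(F)|$ for all $t\in\mathbb{N}$ and all $q\in correct(F)$. $\diamond\mathcal{N}(F)$ is the set of all $H$ satisfying Completeness (as just stated) and: (Eventual Accuracy) there is $t\in\mathbb{N}$ such that $H(q,t')\le |crashed(F)|$ for all $t'>t$ and all $q\in correct(F)$. Reductions. An anonymous failure detector $\mathcal{D}'$ can be reduced to another failure detector $\mathcal{D}$ (''$\mathcal{D}$ is stronger than $\mathcal{D}'$'') if there is a (deterministic) algorithm $T_{\mathcal{D}\to\mathcal{D}'}$ that transforms $\mathcal{D}$ to $\mathcal{D}'$ under an environment $\mathcal{E}$: using $\mathcal{D}$, it maintains a variable $output_p$ at every process $p$, which emulates the output of $\mathcal{D}'$ at $p$, and the history $O$ of all the output variables is required to satisfy $O^{\Pi}\in\mathcal{D}'(F^{\Pi})$, where $F\in\mathcal{E}$ and $\Pi$ is a permutation of the processes. No particular environment is singled out in the result.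
   Formalization: The history O must agree with the variables output_p only while p has not crashed; at crashed processes its values may be chosen freely, since with the last output kept after a crash Completeness (over all q in P) makes the claim false. *)

(* Defs.v *)
From mathcomp Require Import all_boot all_fingroup.
From mathcomp Require Import boolp classical_sets.

Set Implicit Arguments.
Unset Strict Implicit.
Unset Printing Implicit Defensive.

Local Open Scope classical_set_scope.

(* The process p_{i+1} is the index i : 'I_n; the clock is nat. *)
Record pattern (n : nat) := Pattern {
  crashed_at :> nat -> {set 'I_n};
  crash_permanent : forall t, crashed_at t \subset crashed_at t.+1;
  some_correct : exists p, forall t, p \notin crashed_at t }.

Definition crashed n (F : pattern n) : {set 'I_n} :=
  [set p | `[< exists t, p \in F t >]]%SET.

Definition correct n (F : pattern n) : {set 'I_n} := (~: crashed F)%SET.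

Definition environment n := set (pattern n).

Definition history n (V : Type) := 'I_n -> nat -> V.

Definition detector n (V : Type) := pattern n -> set (history n V).

Lemma perm_crash_permanent n (Pi : 'S_n) (F : pattern n) t :
  (Pi @: F t \subset Pi @: F t.+1)%SET.
Proof. exact/imsetS/crash_permanent. Qed.

Lemma perm_some_correct n (Pi : 'S_n) (F : pattern n) :
  exists p, forall t, p \notin (Pi @: F t)%SET.
Proof.
have [p Fp] := some_correct F.
by exists (Pi p) => t; rewrite mem_imset //; exact: perm_inj.
Qed.

Definition perm_pattern n (Pi : 'S_n) (F : pattern n) : pattern n :=
  Pattern (perm_crash_permanent Pi F) (perm_some_correct Pi F).

Definition perm_history n V (Pi : 'S_n) (H : history n V) : history n V :=
  fun p t => H (Pi p) t.

(* The values {0, ..., n} are 'I_n.+1, coerced to nat in comparisons. *)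
Definition completeness n (F : pattern n) (H : history n 'I_n.+1) : Prop :=
  exists t, forall t', t <= t' -> forall q, #|crashed F| <= H q t'.

Definition accuracy n (F : pattern n) (H : history n 'I_n.+1) : Prop :=
  forall t q, q \in correct F -> H q t <= #|crashed F|.

Definition eventual_accuracy n (F : pattern n) (H : history n 'I_n.+1) : Prop :=
  exists t, forall t', t < t' ->
    forall q, q \in correct F -> H q t' <= #|crashed F|.

Definition detN n : detector n 'I_n.+1 :=
  fun F => [set H | completeness F H /\ accuracy F H].

Definition evN n : detector n 'I_n.+1 :=
  fun F => [set H | completeness F H /\ eventual_accuracy F H].

(* Deterministic code, the same at every process and without process names.
   In one atomic step a process receives a vector of values (None: nothing),
   reads its failure detector module, changes state and broadcasts at most one
   message. *)
Record algorithm n (V V' : Type) := Algorithm {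
  state : Type;
  msg : Type;
  init : state;
  step : state -> ('I_n -> option msg) -> V -> state * option msg;
  output : state -> V' }.

(* The message broadcast by j at time s is identified by the pair (j, s):
   delivered i j t = Some s means that i receives it at time t. The value
   received i j t is what the model writes R_i(j, t); the code only sees it with
   the senders shuffled by a permutation that the adversary picks anew at each
   receive, so that neither a sender nor a fixed local port can be recognised. *)
Record run n V V' (A : algorithm n V V') (F : pattern n) (H : history n V) :=
  Run {
    active : 'I_n -> nat -> bool;
    state_of : 'I_n -> nat -> state A;
    sent : 'I_n -> nat -> option (msg A);
    delivered : 'I_n -> 'I_n -> nat -> option nat;
    shuffle : 'I_n -> nat -> 'S_n;
    received := fun i j t => obind (sent j) (delivered i j t);
    run_init : forall p, state_of p 0 = init A;
    run_step : forall p t, active p t ->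
      (state_of p t.+1, sent p t) =
        step (state_of p t) (fun j => received p (shuffle p t j) t) (H p t);
    run_idle : forall p t, ~~ active p t ->
      state_of p t.+1 = state_of p t /\ sent p t = None;
    crashed_inactive : forall p t, p \in F t -> ~~ active p t;
    correct_active : forall p, p \in correct F ->
      forall t, exists2 t', t <= t' & active p t';
    no_creation : forall i j t s, delivered i j t = Some s ->
      [/\ active i t, s < t & sent j s : bool];
    no_duplication : forall i j t t' s,
      delivered i j t = Some s -> delivered i j t' = Some s -> t = t';
    no_loss : forall i j s, i \in correct F -> sent j s ->
      exists t, delivered i j t = Some s }.

(* The output variable of p exists as long as p has not crashed, so a run
   determines the emulated history O exactly at the (p, t) with p \notin F t.
   Freezing the last output of a halted process instead would be too strong:
   completeness also constrains crashed processes, while these cannot react to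
   crashes that occur after their own. *)
Definition reducible n V V' (E : environment n) (D' : detector n V')
    (D : detector n V) : Prop :=
  exists A : algorithm n V V',
    forall F, E F -> forall H, D F H -> forall r : run A F H,
      exists O : history n V',
        (forall p t, p \notin F t -> O p t = output (state_of r p t)) /\
        (forall Pi : 'S_n, D' (perm_pattern Pi F) (perm_history Pi O)).

(* After renaming processes by Pi, the module of Pi p shows what that of p
   showed, hence the inverse on the history: with Pi on both sides, a faulty
   process, whose output accuracy leaves free, could take the place of a correct
   one as soon as Pi is not an involution. *)
Definition anonymous n V (D : detector n V) : Prop :=
  forall (Pi : 'S_n) F H, D F H -> D (perm_pattern Pi F) (perm_history Pi^-1%g H).

Lemma crashed_perm n (Pi : 'S_n) (F : pattern n) p :
  (p \in crashed (perm_pattern Pi F)) = (Pi^-1%g p \in crashed F).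
Proof.
have E t : (p \in perm_pattern Pi F t) = (Pi^-1%g p \in F t).
  by rewrite /= -{1}[p](permKV Pi) mem_imset //; exact: perm_inj.
by rewrite !inE; apply/asboolP/asboolP => -[t]; exists t; rewrite ?E // -E.
Qed.

Lemma card_crashed_perm n (Pi : 'S_n) (F : pattern n) :
  #|crashed (perm_pattern Pi F)| = #|crashed F|.
Proof.
rewrite -[RHS](card_imset _ (@perm_inj _ Pi)); apply: eq_card => p.
rewrite crashed_perm -{2}[p](permKV Pi) mem_imset //; exact: perm_inj.
Qed.

Lemma correct_perm n (Pi : 'S_n) (F : pattern n) p :
  (p \in correct (perm_pattern Pi F)) = (Pi^-1%g p \in correct F).
Proof. by rewrite /correct !finset.in_setC crashed_perm. Qed.

Lemma anonymous_detN n : anonymous (@detN n).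
Proof.
move=> Pi F H [[t Ht] HA]; split.
  by exists t => t' tt' q; rewrite card_crashed_perm; exact: Ht.
by move=> s q; rewrite correct_perm card_crashed_perm; exact: HA.
Qed.

Lemma anonymous_evN n : anonymous (@evN n).
Proof.
move=> Pi F H [[t Ht] [s HA]]; split.
  by exists t => t' tt' q; rewrite card_crashed_perm; exact: Ht.
by exists s => s' ss' q; rewrite correct_perm card_crashed_perm; exact: HA.
Qed.

(* Main.v *)
(** Every process repeatedly copies the output of its N-module into its state.
    From some time on the module of a correct process shows exactly the number
    of crashed processes, hence so does its output after its next step. Faulty
    processes eventually crash, after which their emulated output is chosen to
    be that number as well. So the emulated history is eventually constant at
    all processes, which makes it insensitive to permutations. *)
From mathcomp Require Import all_boot all_fingroup.
From mathcomp Require Import boolp classical_sets.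
Require Import Defs.

Set Implicit Arguments.
Unset Strict Implicit.
Unset Printing Implicit Defensive.

Lemma crashed_at_mono n (F : pattern n) s t : s <= t -> F s \subset F t.
Proof.
move=> st; rewrite -(subnK st); elim: (t - s) => [|k IHk]; first exact: subxx.
exact: fintype.subset_trans IHk (crash_permanent F (k + s)).
Qed.

Lemma fin_eventually (T : finType) (P : T -> nat -> Prop) :
  (forall x, exists s, forall t, s <= t -> P x t) ->
  exists s, forall t, s <= t -> forall x, P x t.
Proof.
move=> /fin_all_exists[f Hf]; exists (\max_x f x) => t le_t x.
exact/Hf/(leq_trans _ le_t)/leq_bigmax.
Qed.

Definition copy_algorithm n V (v0 : V) : algorithm n V V :=
  @Algorithm n V V V unit v0 (fun _ _ v => (v, None)) id.

(** After the first step of [p] at or after time [s], its state is always a value read at some time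
    at or after [s], since idling keeps it. *)
Lemma copy_state_inv n V (v0 : V) (F : pattern n) (H : history n V)
    (r : run (copy_algorithm n v0) F H) (P : V -> Prop) p s :
  p \in correct F -> (forall t, s <= t -> P (H p t)) ->
  exists s', forall t, s' <= t -> P (state_of r p t).
Proof.
move=> pF HP; have [a sa act_a] := correct_active r pF s.
exists a.+1; elim=> // t IHt; rewrite ltnS => at_.
have [act|idle] := boolP (active r p t).
  by have [-> _] := run_step act; exact/HP/(leq_trans sa).
have [-> _] := run_idle idle; apply: IHt.
(* An idle time [t] differs from [a], at which [p] steps. *)
by rewrite ltn_neqAle at_ andbT; apply: contraNneq idle => <-.
Qed.

Lemma eventually_exact_evN n (F : pattern n) (O : history n 'I_n.+1) s :
  (forall t, s <= t -> forall p, O p t = #|crashed F| :> nat) ->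
  forall Pi, evN (perm_pattern Pi F) (perm_history Pi O).
Proof.
move=> HO Pi; split; exists s => t st q; rewrite card_crashed_perm.
  by rewrite /perm_history HO.
by rewrite /perm_history HO // ltnW.
Qed.

Theorem theorem4p1 (n : nat) (E : environment n) :
  reducible E (@evN n) (@detN n).
Proof.
exists (copy_algorithm n ord0) => F _ H [[s Hge] Hle] r.
pose O p t : 'I_n.+1 :=
  if p \in F t then inord #|crashed F| else state_of r p t.
exists O; split=> [p t /negbTE pFt|]; first by rewrite /O pFt.
(* At most [n] processes crash, so [inord] does not fall back to its default. *)
have inordF : (inord #|crashed F| : 'I_n.+1) = #|crashed F| :> nat.
  by apply: inordK; rewrite ltnS -[leqRHS]card_ord max_card.
suff [s' HO]: exists s', forall t, s' <= t -> forall p, O p t = #|crashed F| :> nat.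
  exact: eventually_exact_evN HO.
apply: fin_eventually => p; have [|pF] := boolP (p \in crashed F).
  rewrite inE => /asboolP[u pFu]; exists u => t ut.
  by rewrite /O (fintype.subsetP (crashed_at_mono F ut)).
have pcorr : p \in correct F by rewrite finset.in_setC.
have Heq t : s <= t -> H p t = #|crashed F| :> nat.
  (* Accuracy bounds the output above, completeness below. *)
  by move=> st; apply/eqP; rewrite eqn_leq Hle // Hge.
have [u Hu] := copy_state_inv r
  (P := fun v : 'I_n.+1 => v = #|crashed F| :> nat) pcorr Heq.
by exists u => t ut; rewrite /O; case: ifP => // _; exact: Hu.
Qed.
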